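(* Let $1\le k\le n$ and let $l_1,\dots,l_k\in\mathbb{R}[Z_1,\dots,Z_n]$ be linearly independent linear forms. Let $S\subseteq\mathbb{R}^n$ be a symmetric $(l_1,\dots,l_k)$-sufficient semi-algebraic set and let $f\in\mathbb{R}[X_1,\dots,X_n]$ be a symmetric polynomial. (1) If $f$ is $(l_1,\dots,l_k)$-sufficient, then $f$ is $(k+1)$-complete on $S$. (2) If $f$ is $(l_1,\dots,l_k)$-concave-sufficient, then $f$ is $(k+2)$-testable on $S$. (3) If $f$ is $(l_1,\dots,l_k)$-quasi-sufficient and $S\cap\mathcal{A}_k$ is connected, then $f$ is $(k+2)$-complete on $S$. Moreover, if $Z_1\in\operatorname{span}(l_1,\dots,l_k)$, then in (1) the conclusion can be replaced by: $f$ is $k$-complete on $S$. If $Z_1,Z_2\in\operatorname{span}(l_1,\dots,l_k)$, then $(k+2)$ in (2) and (3) can be replaced by $k$.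
   Context: Completeness and testability: for $m\in\mathbb{N}$ let $\mathcal{A}_m:=\{x\in\mathbb{R}^n : |\{x_1,\dots,x_n\}|\le m\}$ be the set of points with at most $m$ distinct coordinates. A symmetric polynomial $f$ is $m$-complete on $S\subseteq\mathbb{R}^n$ if $f(S)=f(S\cap\mathcal{A}_m)$, and $m$-testable on $S$ if $\inf_{x\in S}f(x)=\inf_{x\in S\cap\mathcal{A}_m}f(x)$. Hyperbolic slices: let $L:\mathbb{R}^n\to\mathbb{R}^k$, $z\mapsto(l_1(z),\dots,l_k(z))$, let $\mathcal{H}$ be the set of all $z\in\mathbb{R}^n$ for which $T^n-z_1T^{n-1}+\dots+(-1)^nz_n$ has only real roots, and for $a\in\mathbb{R}^k$ let $\mathcal{H}_L(a):=\mathcal{H}\cap L^{-1}(a)$. Sufficiency: let $e_1,\dots,e_n$ be the elementary symmetric polynomials in $X_1,\dots,X_n$. Every symmetric $f$ is uniquely $f=g(e_1,\dots,e_n)$ with $g\in\mathbb{R}[Z_1,\dots,Z_n]$. - $f$ is $(l_1,\dots,l_k)$-sufficient if $g\in\mathbb{R}[l_1,\dots,l_k]$. - $f$ is $(l_1,\dots,l_k)$-quasi-sufficient if $f=f_0+f_1e_1+\dots+f_ne_n$ for some $(l_1,\dots,l_k)$-sufficient polynomials $f_0,\dots,f_n$. - $f$ is $(l_1,\dots,l_k)$-concave-sufficient if $g$ is concave on $\mathcal{H}_L(a)$ for all $a\in\mathbb{R}^k$. - A symmetric (i.e. invariant under permutation of coordinates) semi-algebraic set $S\subseteq\mathbb{R}^n$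 is $(l_1,\dots,l_k)$-sufficient if it can be described by $(l_1,\dots,l_k)$-sufficient polynomials. *)

(* Defs.v *)
From HB Require Import structures.
From mathcomp Require Import all_boot all_order all_algebra perm.
From mathcomp Require Import all_classical all_reals all_analysis.
(* The notations of mpoly and complex clash with those of mathcomp-analysis. *)
From mathcomp Require Import -(notations) mpoly complex.

Set Implicit Arguments.
Unset Strict Implicit.
Unset Printing Implicit Defensive.

Import Order.TTheory GRing.Theory Num.Theory numFieldNormedType.Exports.
Local Open Scope classical_set_scope.
Local Open Scope ring_scope.

Notation "{ 'mpoly' R [ n ] }" := (mpoly n R)
  (format "{ 'mpoly'  R [ n ] }") : type_scope.

(* Indices are shifted by one throughout: X_{i+1}, Z_{i+1}, l_{i+1}, e_{i+1}
   are the objects of index i : 'I_n (or 'I_k). *)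

Definition peval (R : realType) (n : nat) (p : {mpoly R[n]})
    (x : 'rV[R]_n) : R :=
  meval (x ord0) p.

Definition distinct_le (R : realType) (n m : nat) : set 'rV[R]_n :=
  [set x | (size (undup (codom (fun i : 'I_n => x ord0 i))) <= m)%N].

Definition complete (R : realType) (n m : nat) (S : set 'rV[R]_n)
    (f : {mpoly R[n]}) : Prop :=
  peval f @` S = peval f @` (S `&` distinct_le m).

(* The infima are taken in the extended reals, with inf set0 = +oo. *)
Definition testable (R : realType) (n m : nat) (S : set 'rV[R]_n)
    (f : {mpoly R[n]}) : Prop :=
  ereal_inf ((fun x => (peval f x)%:E) @` S) =
  ereal_inf ((fun x => (peval f x)%:E) @` (S `&` distinct_le m)).

Definition linear_form (R : realType) (n : nat) (p : {mpoly R[n]}) : Prop :=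
  p \is ishomog1 1 mdeg.

Definition lin_indep (R : realType) (n k : nat)
    (l : k.-tuple {mpoly R[n]}) : Prop :=
  forall c : 'I_k -> R,
    \sum_(i < k) c i *: tnth l i = 0 -> forall i, c i = 0.

Definition in_span (R : realType) (n k : nat) (l : k.-tuple {mpoly R[n]})
    (p : {mpoly R[n]}) : Prop :=
  exists c : 'I_k -> R, p = \sum_(i < k) c i *: tnth l i.

Definition mvar (R : realType) (n : nat) (i : 'I_n) : {mpoly R[n]} :=
  mpolyX R (mnm1 i).

Definition hpoly (R : realType) (n : nat) (z : 'rV[R]_n) : {poly R} :=
  'X^n + \sum_(i < n) ((-1) ^+ i.+1 * z ord0 i) *: 'X^(n - i.+1).

Definition only_real_roots (R : realType) (p : {poly R}) : Prop :=
  forall w : complex R,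
    root (map_poly (real_complex R) p) w -> complex.Im w = 0.

Definition hyperbolic (R : realType) (n : nat) : set 'rV[R]_n :=
  [set z | only_real_roots (hpoly z)].

Definition linmap (R : realType) (n k : nat) (l : k.-tuple {mpoly R[n]})
    (z : 'rV[R]_n) : 'rV[R]_k :=
  \row_i peval (tnth l i) z.

Definition hslice (R : realType) (n k : nat) (l : k.-tuple {mpoly R[n]})
    (a : 'rV[R]_k) : set 'rV[R]_n :=
  @hyperbolic R n `&` linmap l @^-1` [set a].

(* Hyperbolic slices need not be convex: concavity on a set D means concavity
   along every line segment contained in D. *)
Definition concave_on (R : realType) (n : nat) (D : set 'rV[R]_n)
    (h : 'rV[R]_n -> R) : Prop :=
  forall z w : 'rV[R]_n,
    (forall t : R, 0 <= t <= 1 -> D (t *: z + (1 - t) *: w)) ->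
    forall t : R, 0 <= t <= 1 ->
      t * h z + (1 - t) * h w <= h (t *: z + (1 - t) *: w).

Definition esyms (R : realType) (n : nat) : n.-tuple {mpoly R[n]} :=
  [tuple mesym n R i.+1 | i < n].

Definition in_subalg (R : realType) (n k : nat) (l : k.-tuple {mpoly R[n]})
    (g : {mpoly R[n]}) : Prop :=
  exists h : {mpoly R[k]}, g = comp_mpoly l h.

(* In the next definitions the g such that f = g(e_1, .., e_n) is unique
   (msym_fundamental_un), and exists when f is symmetric (sym_fundamental). *)
Definition sufficient (R : realType) (n k : nat) (l : k.-tuple {mpoly R[n]})
    (f : {mpoly R[n]}) : Prop :=
  exists g : {mpoly R[n]}, f = comp_mpoly (esyms R n) g /\ in_subalg l g.

Definition quasi_sufficient (R : realType) (n k : nat)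
    (l : k.-tuple {mpoly R[n]}) (f : {mpoly R[n]}) : Prop :=
  exists (f0 : {mpoly R[n]}) (fe : 'I_n -> {mpoly R[n]}),
    [/\ sufficient l f0, forall i, sufficient l (fe i) &
        f = f0 + \sum_(i < n) fe i * mesym n R i.+1].

Definition concave_sufficient (R : realType) (n k : nat)
    (l : k.-tuple {mpoly R[n]}) (f : {mpoly R[n]}) : Prop :=
  exists g : {mpoly R[n]}, f = comp_mpoly (esyms R n) g /\
    forall a : 'rV[R]_k, concave_on (hslice l a) (peval g).

Definition symmetric_set (R : realType) (n : nat) (S : set 'rV[R]_n) : Prop :=
  forall (s : {perm 'I_n}) (x : 'rV[R]_n), S x -> S (col_perm s x).

(* The semi-algebraic set described by a finite list of systems (E, P): the
   union of the sets where p = 0 for p in E and q > 0 for q in P. *)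
Definition semialg_set (R : realType) (n : nat)
    (D : seq (seq {mpoly R[n]} * seq {mpoly R[n]})) : set 'rV[R]_n :=
  [set x | exists2 c, c \in D &
     (forall p, p \in c.1 -> peval p x = 0) /\
     (forall q, q \in c.2 -> 0 < peval q x)].

Definition sufficient_set (R : realType) (n k : nat)
    (l : k.-tuple {mpoly R[n]}) (S : set 'rV[R]_n) : Prop :=
  exists D : seq (seq {mpoly R[n]} * seq {mpoly R[n]}),
    (forall c, c \in D -> forall p, p \in c.1 ++ c.2 -> sufficient l p) /\
    S = semialg_set D.

(* Main.v *)
(* Write E x = (e_1(x), .., e_n(x)). If x has d distinct coordinates, write
   prod (T - x_i) = Q W with Q squarefree of degree d. For deg q < d and small t
   the polynomial (Q + t q) W still has only real roots, so E x lies in the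
   interior of a segment of hyperbolic points in each of d independent
   directions q W; m linear conditions with m < d leave such a direction. Hence
   a concave function on a fibre of m linear forms, if its sublevel sets are
   compact, attains its minimum at some x with at most m distinct coordinates.
   Compactness comes from |x|^2 = e_1^2 - 2 e_2. Fixing e_1 and e_2 gives the
   statements with k + 2; for sufficient f one fixes e_1 only and minimises
   -e_2, which gives k + 1. A quasi-sufficient f is affine on each fibre:
   for the bound k + 2, fix this affine function too and argue as for sufficient
   f, which does not use connectedness; for the bound k, use its minimum and its
   maximum on the fibre and the connectedness. *)
Require Import Defs.
From HB Require Import structures.
From mathcomp Require Import all_boot all_order all_algebra perm.
From mathcomp Require Import all_classical all_reals all_analysis.
From mathcomp Require Import -(notations) mpoly complex.
From mathcomp Require Import polyrcf.
From mathcomp Require Import ring lra zify.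
Import Order.TTheory GRing.Theory Num.Theory numFieldNormedType.Exports.
Local Open Scope classical_set_scope.
Local Open Scope ring_scope.
Set Implicit Arguments.
Unset Strict Implicit.
Unset Printing Implicit Defensive.

(** * Small perturbations of polynomials with simple real roots *)

Lemma near_seq (T : Type) (F : set_system T) {FF : Filter F} (I : eqType)
    (s : seq I) (P : I -> T -> Prop) :
  (forall i, i \in s -> \forall t \near F, P i t) ->
  \forall t \near F, forall i, i \in s -> P i t.
Proof.
elim: s => [|i s IHs] Ps; first exact: nearW.
have Pi := Ps i (mem_head i s).
have {}IHs := IHs (fun j js => Ps j (mem_behead (s := i :: s) js)).
near=> t => j; rewrite inE => /predU1P[->|].
  by near: t.
by move: j; near: t.
Unshelve. all: by end_near. Qed.

(* Around each root r of the squarefree product, the product changes sign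
   between r - e and r + e; these sign changes survive a small perturbation. *)
Lemma split_perturb (R : realType) (s : seq R) (q : {poly R}) :
  uniq s -> (size q <= size s)%N ->
  \forall t \near (0 : R), exists2 s' : seq R, size s' = size s &
    \prod_(r <- s) ('X - r%:P) + t *: q = \prod_(r <- s') ('X - r%:P).
Proof.
move=> s_uniq szq; set Q := \prod_(r <- s) _.
(* With this radius the intervals around distinct roots are disjoint. *)
have [e e0 e_sep] : exists2 e : R, 0 < e &
    forall r, r \in s -> forall u, u \in s -> r != u -> e + e < `|r - u|.
  have : \forall e \near (0 : R)^'+,
      forall r, r \in s -> forall u, u \in s -> r != u -> e + e < `|r - u|.
    apply: near_seq => r _; apply: near_seq => u _.
    have [->|ru] := eqVneq r u; first exact: nearW.
    have : 0 < `|r - u| / 2 by rewrite divr_gt0// normr_gt0 subr_eq0.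
    by move=> /nbhs_right_lt; apply: filterS => e eru _; lra.
  move=> near_sep.
  have : \forall e \near (0 : R)^'+, 0 < e /\
      forall r, r \in s -> forall u, u \in s -> r != u -> e + e < `|r - u|.
    by apply: filterI => //; exact: nbhs_right_gt.
  by move=> /filter_ex[e [e0 e_sep]]; exists e.
(* The factor of [r] contributes [-e^2]; every other factor has the same sign at both ends, its root
   being more than [2e] away. *)
have Q_sign r : r \in s -> Q.[r - e] * Q.[r + e] < 0.
  move=> rs; rewrite /Q (big_rem r rs)/= !hornerM !hornerXsubC mulrACA.
  rewrite pmulr_llt0; first by nra.
  rewrite !horner_prod -big_split/= big_seq_cond prodr_gt0// => u.
  rewrite andbT mem_rem_uniq// inE => /andP[ur us].
  have ru : r != u by rewrite eq_sym.
  rewrite !hornerXsubC.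
  have := e_sep _ rs _ us ru.
  by case: (ltrgt0P (r - u)) => ? ?; nra.
have : \forall t \near (0 : R), forall r, r \in s ->
    (Q + t *: q).[r - e] * (Q + t *: q).[r + e] < 0.
  apply: (near_seq (F := nbhs (0 : R))) => r /Q_sign Qr.
  pose g (t : R) := (Q.[r - e] + t * q.[r - e]) * (Q.[r + e] + t * q.[r + e]).
  have g0 : g 0 < 0 by rewrite /g !mul0r !addr0.
  have cg : {for 0, continuous g}.
    by apply: cvgM; apply: cvgD; [exact: cvg_cst|apply: cvgMl; exact: cvg_id|
      exact: cvg_cst|apply: cvgMl; exact: cvg_id].
  near=> t; rewrite !hornerE.
  by near: t; exact: cvgr_lt cg _ g0.
move=> Qt_near; near=> t.
have Qt : forall r, r \in s -> (Q + t *: q).[r - e] * (Q + t *: q).[r + e] < 0.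
  by near: t; exact: Qt_near.
have root_near r : exists y, r \in s -> `|y - r| < e /\ root (Q + t *: q) y.
  have [rs|/negbTE rs] := boolP (r \in s); last by exists 0.
  have [|y /itvP yre yroot] := poly_ivtoo _ (Qt r rs); first by lra.
  by exists y => _; rewrite ltr_distl !yre.
have [y yP] := choice root_near.
exists (map y s); first by rewrite size_map.
have szQ : size Q = (size s).+1 by rewrite size_prod_XsubC.
have sztq : (size (t *: q) < size Q)%N.
  by rewrite szQ ltnS (leq_trans (size_scale_leq _ _)).
have lcQ : lead_coef (Q + t *: q) = 1.
  by rewrite lead_coefDl// (monicP _)// monic_prod_XsubC.
(* A monic polynomial of degree [size s] with that many distinct roots splits. *)
rewrite [LHS](@all_roots_prod_XsubC _ _ (map y s)) ?lcQ ?scale1r//.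
- by rewrite size_polyDl ?size_map.
- by apply/allP => _ /mapP[r rs ->]; exact: (yP r rs).2.
rewrite uniq_rootsE map_inj_in_uniq// => r u rs us yru.
apply/eqP; apply: contraT => ru.
have := e_sep _ rs _ us ru.
have [] := yP _ rs; have [] := yP _ us; rewrite yru => h1 _ h2 _.
have : `|r - u| <= `|y u - r| + `|y u - u|.
  by rewrite (distrC (y u) r); apply: ler_distD.
lra.
Unshelve. all: by end_near. Qed.

(** * Coefficient vectors and their perturbation *)

(** The map [E] of the opening comment. Parametrising fibres by [x] makes hyperbolicity
    automatic. *)
Definition esym_vec (R : realType) (n : nat) (x : 'rV[R]_n) : 'rV[R]_n :=
  \row_i peval (mesym n R i.+1) x.

Lemma poly_sum_rev (R : nzRingType) (n : nat) (p : {poly R}) :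
  (size p <= n)%N -> p = \sum_(i < n) p`_(n - i.+1) *: 'X^(n - i.+1).
Proof.
move=> szp; rewrite (reindex_inj rev_ord_inj)/=.
under eq_bigr => i _ do rewrite subnSK// subKn 1?ltnW//.
rewrite -poly_def; apply/polyP => j; rewrite coef_poly; case: ltnP => // nj.
by rewrite nth_default// (leq_trans szp).
Qed.

Lemma hpolyD (R : realType) (n : nat) (z v : 'rV[R]_n) :
  hpoly (z + v) =
  hpoly z + \sum_(i < n) ((-1) ^+ i.+1 * v ord0 i) *: 'X^(n - i.+1).
Proof.
rewrite /hpoly -addrA -big_split/=; congr (_ + _).
by apply: eq_bigr => i _; rewrite mxE mulrDr scalerDl.
Qed.

(** Lets equalities of coefficient vectors be checked on polynomials, where roots are visible. *)
Lemma hpoly_inj (R : realType) (n : nat) : injective (@hpoly R n).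
Proof.
move=> z w zw; apply/rowP => i.
have coefE (u : 'rV[R]_n) : (hpoly u)`_(n - i.+1) = (-1) ^+ i.+1 * u ord0 i.
  rewrite coefD coefXn coef_sum [_ == n]ltn_eqF ?add0r; last first.
    by have := ltn_ord i; lia.
  rewrite (bigD1 i)//= coefZ coefXn eqxx mulr1 big1 ?addr0// => j ji.
  rewrite coefZ coefXn; case: eqP => [nij|]; last by rewrite mulr0.
  case/eqP: ji; apply: val_inj => /=.
  by have := ltn_ord i; have := ltn_ord j; lia.
have := congr1 (fun p : {poly R} => p`_(n - i.+1)) zw; rewrite !coefE.
by apply: mulfI; rewrite signr_eq0.
Qed.

(** Vieta's formulas. *)
Lemma hpoly_esym (R : realType) (n : nat) (x : 'rV[R]_n) :
  hpoly (esym_vec x) = \prod_(i < n) ('X - (x ord0 i)%:P).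
Proof.
set P := \prod_(i < n) _.
have szP : size P = n.+1 by rewrite size_prod_XsubC /index_enum -enumT size_enum_ord.
have monP : P \is monic by exact: monic_prod_XsubC.
have szPX : (size (P - 'X^n)%R <= n)%N.
  apply/leq_sizeP => j; rewrite leq_eqVlt => /predU1P[<-|nj].
    by move/monicP: monP; rewrite lead_coefE szP coefB coefXn eqxx => ->; rewrite subrr.
  by rewrite coefB coefXn gtn_eqF// subr0 nth_default// szP.
rewrite -[RHS](subrKC 'X^n) (poly_sum_rev szPX) /hpoly; congr (_ + _).
apply: eq_bigr => i _; congr (_ *: _).
pose c := [tuple x ord0 j | j < n].
have PE : P = \prod_(r <- c) ('X - r%:P).
  by rewrite big_tuple; apply: eq_bigr => j _; rewrite tnth_mktuple.
rewrite coefB coefXn [_ == n]ltn_eqF ?subr0; last by have := ltn_ord i; lia.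
rewrite mxE PE -[i.+1]/(nat_of_ord (lift ord0 i)) mroots_coeff; congr (_ * _).
by apply: meval_eq => j; rewrite tnth_mktuple.
Qed.

Lemma hpoly_esym_seq (R : realType) (n : nat) (s : seq R) : size s = n ->
  hpoly (esym_vec (\row_(i < n) s`_i)) = \prod_(r <- s) ('X - r%:P).
Proof.
move=> szs; rewrite hpoly_esym (big_nth 0) szs big_mkord.
by apply: eq_bigr => i _; rewrite mxE.
Qed.

Lemma esym_perturb (R : realType) (n m : nat) (A : 'M[R]_(n, m))
    (x : 'rV[R]_n) : ~ distinct_le m x ->
  exists v : 'rV[R]_n, [/\ v != 0, v *m A = 0 &
    \forall t \near (0 : R), exists y, esym_vec y = esym_vec x + t *: v].
Proof.
rewrite /distinct_le/= => /negP; rewrite -ltnNge.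
set c := codom _; set s := undup c => md.
(* [s'] collects the repeated occurrences; they are the roots of the cofactor [W] of the squarefree
   part. *)
have [s' cs] := perm_to_subseq (undup_subseq c); rewrite -/s in cs.
have szc : size c = n by rewrite size_codom card_ord.
have szn : (size s + size s' = n)%N by rewrite -size_cat -(perm_size cs).
pose W := \prod_(r <- s') ('X - r%:P).
have szW : size W = (size s').+1 by rewrite size_prod_XsubC.
have W0 : W != 0 by rewrite -size_poly_gt0 szW.
(* Row [j] is the direction [X^j W], with the signs of [hpoly]. *)
pose B : 'M[R]_(size s, n) :=
  \matrix_(j, i) ((-1) ^+ i.+1 * ('X^j * W)`_(n - i.+1)).
(* [B *m A] has more than [m] rows but [m] columns, so its left kernel is nonzero. *)
pose q := nz_row (kermx (B *m A)).
have q0 : q != 0.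
  rewrite nz_row_eq0 -mxrank_eq0 -lt0n mxrank_ker subn_gt0.
  by rewrite (leq_ltn_trans _ md)// rank_leq_col.
have qBA : q *m B *m A = 0 by rewrite -mulmxA; apply/sub_kermxP; exact: nz_row_sub.
have szq : (size (rVpoly q) <= size s)%N by exact: size_poly.
pose h := rVpoly q * W.
have szh : (size h <= n)%N.
  rewrite /h; have [->|h0] := eqVneq (rVpoly q) 0; first by rewrite mul0r size_poly0.
  by rewrite (leq_trans (size_polyMleq _ _))// szW addnS/= -szn leq_add2r.
have vE (i : 'I_n) : (-1) ^+ i.+1 * (q *m B) ord0 i = h`_(n - i.+1).
  rewrite mxE mulr_sumr /h [X in rVpoly X]row_sum_delta.
  rewrite linear_sum mulr_suml.
  rewrite coef_sum; apply: eq_bigr => j _.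
  by rewrite linearZ/= rVpoly_delta -scalerAl coefZ mxE mulrCA signrMK.
exists (q *m B); split => //.
  apply: contra_neq q0 => qB0; apply: (can_inj rVpolyK); rewrite linear0.
  suff /eqP : h = 0 by rewrite mulf_eq0 (negbTE W0) orbF => /eqP.
  rewrite (poly_sum_rev szh) big1// => i _.
  by rewrite -vE qB0 mxE mulr0 scale0r.
have := split_perturb (undup_uniq c) szq; apply: filterS => t [s2 szs2 Es2].
(* The moved roots [s2] of the squarefree part, followed by the unmoved roots of [W]. *)
exists (\row_(i < n) (s2 ++ s')`_i); apply: hpoly_inj.
rewrite hpoly_esym_seq ?size_cat ?szs2// big_cat/= -Es2 mulrDl -big_cat/=.
rewrite -(perm_big _ cs)/= hpolyD hpoly_esym big_image; congr (_ + _).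
rewrite -scalerAl [_ * _](poly_sum_rev szh) scaler_sumr; apply: eq_bigr => i _.
by rewrite -vE [in RHS]mxE mulrCA scalerA.
Qed.

(** * Topology of the fibres and minima of concave functions on them *)

Lemma continuous_peval (R : realType) (n : nat) (p : {mpoly R[n]}) :
  continuous (peval p).
Proof.
rewrite /peval (_ : (fun x => _) = fun x : 'rV[R]_n =>
    \sum_(m <- msupp p) mcoeff m p * \prod_(i < n) x ord0 i ^+ m i); last first.
  by apply/funext => x; rewrite mevalE.
apply: continuous_big => [|m _]; first exact: add_continuous.
have prod_cts : continuous (fun x : 'rV[R]_n => \prod_(i < n) x ord0 i ^+ m i).
  apply: continuous_big => [|i _]; first exact: mul_continuous.
  move=> y; apply: (@continuous_comp _ _ _ (fun x : 'rV[R]_n => x ord0 i)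
    (fun r : R => r ^+ m i)); first exact: coord_continuous.
  exact: exprn_continuous.
by move=> x; apply: (continuousM (cvg_cst _) (prod_cts x)).
Qed.

Lemma peval_esyms (R : realType) (n : nat) (g : {mpoly R[n]}) (x : 'rV[R]_n) :
  peval (comp_mpoly (esyms R n) g) x = peval g (esym_vec x).
Proof.
by rewrite /peval comp_mpoly_meval; apply: meval_eq => i; rewrite tnth_mktuple mxE.
Qed.

Lemma closed_peval_eq (R : realType) (n : nat) (p : {mpoly R[n]}) (c : R) :
  closed [set x | peval p x = c].
Proof.
by apply: (@preimage_closed _ _ (peval p) [set c]);
  [move=> x _; exact: continuous_peval|exact: closed_eq].
Qed.

Lemma closed_peval_le (R : realType) (n : nat) (p : {mpoly R[n]}) (c : R) :
  closed [set x | peval p x <= c].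
Proof.
by apply: (@preimage_closed _ _ (peval p) [set y | y <= c]);
  [move=> x _; exact: continuous_peval|exact: closed_le].
Qed.

(** Each coordinate of the image is a polynomial in [x], so the fibre is an intersection of closed
    sets. *)
Lemma closed_esym_fiber (R : realType) (n m : nat) (A : 'M[R]_(n, m))
    (a : 'rV[R]_m) : closed [set x | esym_vec x *m A = a].
Proof.
rewrite (_ : [set x | _] = \bigcap_(j in setT) [set x |
    peval (\sum_(i < n) A i j *: mesym n R i.+1) x = a ord0 j]); last first.
  have coordE x j : peval (\sum_(i < n) A i j *: mesym n R i.+1) x =
      (esym_vec x *m A) ord0 j.
    rewrite /peval raddf_sum mxE; apply: eq_bigr => i _.
    by rewrite /= mevalZ mulrC mxE.
  apply/seteqP; split => [x /= <- j _ /=|x xa]; first exact: coordE.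
  by apply/rowP => j; rewrite -coordE; exact: xa.
by apply: closed_bigI => j _; exact: closed_peval_eq.
Qed.

Lemma compact_sum_sqr (R : realType) (n : nat) (K : set 'rV[R]_n) (C : R) :
  closed K -> (forall x, K x -> \sum_(i < n) x ord0 i ^+ 2 <= C) -> compact K.
Proof.
move=> cK KC; apply: bounded_closed_compact => //.
(* This bound avoids a square root: [C >= 0] and [M > C + 1] give [C < M^2]. *)
exists (C + 1); split; first exact: num_real.
move=> M CM x /KC xC; rewrite /= [X in X <= _]mx_normrE.
have xiC i : x ord0 i ^+ 2 <= C.
  rewrite (le_trans _ xC)// (bigD1 i)//= lerDl sumr_ge0// => j _.
  exact: sqr_ge0.
have C0 : 0 <= C by rewrite (le_trans _ xC)// sumr_ge0// => j _; exact: sqr_ge0.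
apply: bigmax_le => [|[i j] _] /=; first by lra.
rewrite (ord1 i) ler_norml; have := xiC j; nra.
Qed.

(* Minimise g on the fibre, then maximise the strictly convex |E x|^2 among the
   minimisers: a point with more than m distinct coordinates would be the
   midpoint of a segment of minimisers. *)
Lemma min_few_distinct (R : realType) (n m : nat) (A : 'M[R]_(n, m))
    (g : {mpoly R[n]}) (x0 : 'rV[R]_n) (C : R) :
  concave_on (range (@esym_vec R n) `&` [set z | z *m A = esym_vec x0 *m A])
    (peval g) ->
  (forall x, esym_vec x *m A = esym_vec x0 *m A ->
    peval g (esym_vec x) <= peval g (esym_vec x0) ->
    \sum_(i < n) x ord0 i ^+ 2 <= C) ->
  exists y, [/\ esym_vec y *m A = esym_vec x0 *m A,
    peval g (esym_vec y) <= peval g (esym_vec x0) & distinct_le m y].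
Proof.
set a := esym_vec x0 *m A => g_concave bndC.
pose ge := comp_mpoly (esyms R n) g.
have geE x : peval ge x = peval g (esym_vec x) by exact: peval_esyms.
pose N := \sum_(i < n) mesym n R i.+1 ^+ 2.
have NE x : peval N x = \sum_(i < n) (esym_vec x) ord0 i ^+ 2.
  rewrite /peval raddf_sum; apply: eq_bigr => i _.
  by rewrite /= rmorphXn/= mxE.
pose K := [set x | esym_vec x *m A = a] `&`
  [set x | peval ge x <= peval g (esym_vec x0)].
have cK : compact K.
  apply: (@compact_sum_sqr _ _ _ C).
    by apply: closedI; [exact: closed_esym_fiber|exact: closed_peval_le].
  by move=> x [/= xa]; rewrite geE; exact: bndC.
have K0 : K !=set0 by exists x0; split => //=; rewrite geE.
have peval_within (p : {mpoly R[n]}) (D : set 'rV[R]_n) : {within D, continuous (peval p)}.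
  by apply: continuous_subspaceT => x; exact: continuous_peval.
have [c] := EVT_min_rV K0 cK (peval_within ge K).
rewrite inE => -[/= ca]; rewrite geE => cx0 cmin.
pose M := [set x | esym_vec x *m A = a] `&`
  [set x | peval ge x = peval g (esym_vec c)].
have cM : compact M.
  apply: (subclosed_compact _ cK).
    by apply: closedI; [exact: closed_esym_fiber|exact: closed_peval_eq].
  by move=> x [/= xa xc]; split => //=; rewrite xc.
have M0 : M !=set0 by exists c; split => //=; rewrite geE.
have [y] := EVT_max_rV M0 cM (peval_within N M).
rewrite inE => -[/= ya]; rewrite geE => yc ymax.
exists y; split => //; first by rewrite yc.
apply: contrapT => /(esym_perturb A)[v [v0 vA]].
move=> /nbhs_ballP[d /= d0 dv].
(* Halving the radius keeps both endpoints [-e] and [e] inside the open ball. *)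
pose e := d / 2.
have in_range t : `|t| <= e -> exists y', esym_vec y' = esym_vec y + t *: v.
  by move=> te; apply: dv; rewrite -ball_normE/= sub0r normrN; rewrite /e in te; lra.
have e0 : 0 < e by rewrite /e; lra.
have [|yp ypE] := in_range e; first by rewrite gtr0_norm.
have [|ym ymE] := in_range (- e); first by rewrite normrN gtr0_norm.
have fiber t : (esym_vec y + t *: v) *m A = a.
  by rewrite mulmxDl ya -scalemxAl vA scaler0 addr0.
(* Points of the fibre outside [K] have values above the one at [x0], so [c] is a minimum on the
   whole fibre and [M] is the set of minimisers. *)
have above_c x : esym_vec x *m A = a -> peval g (esym_vec c) <= peval g (esym_vec x).
  move=> xa; have [xx0|/ltW x0x] := leP (peval g (esym_vec x)) (peval g (esym_vec x0)).
    by rewrite -(geE x); apply: cmin; rewrite inE; split => //=; rewrite geE.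
  exact: le_trans x0x.
have ypa : esym_vec yp *m A = a by rewrite ypE.
have yma : esym_vec ym *m A = a by rewrite ymE.
have mid t : t *: esym_vec yp + (1 - t) *: esym_vec ym =
    esym_vec y + ((t + t - 1) * e) *: v.
  by rewrite ypE ymE; apply/rowP => i; rewrite !mxE; ring.
(* At [t = 1/2] the segment passes through the image of the minimiser [y]; concavity then makes both
   [yp] and [ym] minimisers. *)
have := g_concave (esym_vec yp) (esym_vec ym) _ 2^-1.
rewrite !mid => gmid.
have {}gmid : 2^-1 * peval g (esym_vec yp) + (1 - 2^-1) * peval g (esym_vec ym) <=
    peval g (esym_vec y).
  rewrite [X in _ <= peval g X](_ : _ = esym_vec y + ((2^-1 + 2^-1 - 1) * e) *: v).
    apply: gmid; last by lra.
    move=> t /andP[t0 t1]; rewrite mid; split; last exact: fiber.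
    have [|y' <-] := in_range ((t + t - 1) * e); last by exists y'.
    by rewrite ler_norml; apply/andP; split; nra.
  rewrite (_ : 2^-1 + 2^-1 - 1 = 0) ?mul0r ?scale0r ?addr0//; lra.
have gp := above_c _ ypa; have gm := above_c _ yma.
have Np : peval N yp <= peval N y.
  by apply: ymax; rewrite inE; split => //=; rewrite geE; lra.
have Nm : peval N ym <= peval N y.
  by apply: ymax; rewrite inE; split => //=; rewrite geE; lra.
(* Parallelogram identity: the squared norms at the two endpoints exceed twice the one at the
   midpoint by [2 e^2 |v|^2], while [y] maximises [N] on [M]. *)
have : \sum_(i < n) v ord0 i ^+ 2 <= 0.
  rewrite -(pmulr_rle0 _ (_ : 0 < 2 * e ^+ 2)); last by rewrite mulr_gt0// exprn_gt0.
  have -> : 2 * e ^+ 2 * \sum_(i < n) v ord0 i ^+ 2 =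
      peval N yp + peval N ym - 2 * peval N y.
    rewrite !NE !mulr_sumr -big_split/= -sumrB; apply: eq_bigr => i _.
    by rewrite ypE ymE !mxE; ring.
  lra.
apply/negP; rewrite -ltNge lt_neqAle sumr_ge0 ?andbT => [|i _]; last exact: sqr_ge0.
apply: contra_neq v0 => /esym v0; apply/rowP => i.
have := psumr_eq0P (fun j _ => sqr_ge0 (v ord0 j)) v0 (i := i) isT.
by rewrite mxE => /eqP; rewrite sqrf_eq0 => /eqP.
Qed.

(** * Fibres on which e_1, or both e_1 and e_2, are fixed *)

(** Newton's identity for the second power sum, by induction on the number of variables. *)
Lemma sqr_mesym1 (R : comNzRingType) (n : nat) :
  mesym n R 1 ^+ 2 = \sum_(i < n) mpolyX R (mnm1 i) ^+ 2 + mesym n R 2 *+ 2.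
Proof.
elim: n => [|n IHn].
  by rewrite big_ord0 mesym1E big_ord0 mesym_geqnE// mul0rn addr0 expr0n.
rewrite big_ord_recr/= !mesymSS mesym0E mwiden1 mul1r sqrrD -rmorphXn/= IHn.
rewrite mwidenD mwidenMn raddf_sum/=.
under [X in X + mwiden _ *+ 2]eq_bigr => i _ do rewrite rmorphXn/= mwidenX mnmwiden1.
by rewrite mulrnDl [RHS]addrAC; congr (_ + _); exact/esym/addrA.
Qed.

Lemma sum_sqr_esym (R : realType) (n : nat) (x : 'rV[R]_n) (i0 i1 : 'I_n) :
  i0 = 0%N :> nat -> i1 = 1%N :> nat ->
  \sum_(i < n) x ord0 i ^+ 2 =
  esym_vec x ord0 i0 ^+ 2 - esym_vec x ord0 i1 *+ 2.
Proof.
move=> i00 i11; rewrite !mxE i00 i11 /peval -mevalMn -rmorphXn/= sqr_mesym1.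
rewrite -mevalB addrK raddf_sum; apply: eq_bigr => i _.
by rewrite /= rmorphXn/= mevalXU.
Qed.

Lemma distinct_le_card (R : realType) (n m : nat) (x : 'rV[R]_n) :
  (n <= m)%N -> distinct_le m x.
Proof.
move=> nm; rewrite /distinct_le/= (leq_trans (size_undup _))//.
by rewrite size_codom card_ord.
Qed.

(** Once e_1 and e_2 are fixed, |x|^2 is constant on the fibre, which gives the bound for
    compactness. *)
Lemma min_few_distinct_e12 (R : realType) (n m : nat) (A : 'M[R]_(n, m))
    (g : {mpoly R[n]}) (x0 : 'rV[R]_n) : (0 < m)%N ->
  (forall z w : 'rV[R]_n, z *m A = w *m A ->
    forall i : 'I_n, (i < 2)%N -> z ord0 i = w ord0 i) ->
  concave_on (range (@esym_vec R n) `&` [set z | z *m A = esym_vec x0 *m A])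
    (peval g) ->
  exists y, [/\ esym_vec y *m A = esym_vec x0 *m A,
    peval g (esym_vec y) <= peval g (esym_vec x0) & distinct_le m y].
Proof.
(* For [n <= 1] there is no e_2, but then [n <= m] and [x0] itself serves. *)
move=> m0 e12 g_concave; have [n1|n1] := leqP n 1.
  by exists x0; split => //; apply: distinct_le_card; rewrite (leq_trans n1).
pose i0 := Ordinal (ltnW n1); pose i1 := Ordinal n1.
apply: (@min_few_distinct _ _ _ A g x0 (\sum_(i < n) x0 ord0 i ^+ 2)) => //.
move=> x /e12 xx0 _.
by rewrite !(@sum_sqr_esym _ _ _ i0 i1)// (xx0 i0)// (xx0 i1).
Qed.

Lemma peval_linear_comb (R : realType) (n : nat) (c : 'I_n -> R)
    (z : 'rV[R]_n) :
  peval (\sum_(i < n) c i *: mvar R i) z = \sum_(i < n) c i * z ord0 i.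
Proof.
rewrite /peval raddf_sum; apply: eq_bigr => i _.
by rewrite /= mevalZ mevalXU.
Qed.

Lemma concave_linear_comb (R : realType) (n : nat) (c : 'I_n -> R)
    (D : set 'rV[R]_n) :
  concave_on D (peval (\sum_(i < n) c i *: mvar R i)).
Proof.
move=> z w _ t _; rewrite !peval_linear_comb !mulr_sumr -big_split/=.
by apply: ler_sum => i _; rewrite !mxE le_eqVlt; apply/orP; left; apply/eqP; ring.
Qed.

(* With e_1 fixed on the fibre, |x|^2 is bounded where e_2 is bounded below. *)
Lemma few_distinct_e1 (R : realType) (n m : nat) (A : 'M[R]_(n, m))
    (x0 : 'rV[R]_n) : (0 < m)%N ->
  (forall z w : 'rV[R]_n, z *m A = w *m A ->
    forall i : 'I_n, i = 0%N :> nat -> z ord0 i = w ord0 i) ->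
  exists y, esym_vec y *m A = esym_vec x0 *m A /\ distinct_le m y.
Proof.
move=> m0 e1; have [n1|n1] := leqP n 1.
  by exists x0; split => //; apply: distinct_le_card; rewrite (leq_trans n1).
pose i0 := Ordinal (ltnW n1); pose i1 := Ordinal n1.
(* Minus the coordinate of e_2: on the sublevel set |x|^2 is at most |x0|^2. *)
pose g := \sum_(i < n) (- (i == i1)%:R : R) *: mvar R i.
have gE z : peval g z = - z ord0 i1.
  rewrite peval_linear_comb (bigD1 i1)// eqxx mulN1r big1 => [|i /negbTE ->].
    exact: addr0.
  by rewrite oppr0 mul0r.
have [||y [yx0 _ ym]] :=
    @min_few_distinct _ _ _ A g x0 (\sum_(i < n) x0 ord0 i ^+ 2).
- exact: concave_linear_comb.
- move=> x /e1 xx0; rewrite !gE !(@sum_sqr_esym _ _ _ i0 i1)// (xx0 i0)//.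
  lra.
- by exists y.
Qed.

(** * Linear forms and sufficiency in terms of fibres *)

Definition form_mx (R : realType) (n k : nat) (l : k.-tuple {mpoly R[n]}) :
    'M[R]_(n, k) :=
  \matrix_(i, j) mcoeff (mnm1 i) (tnth l j).

Lemma linear_formE (R : realType) (n : nat) (p : {mpoly R[n]}) :
  linear_form p -> p = \sum_(i < n) mcoeff (mnm1 i) p *: mvar R i.
Proof.
move=> p1; apply/mpolyP => m; rewrite raddf_sum/=.
have [m1|m1] := eqVneq (mdeg m) 1%N; last first.
  rewrite (dhomog_nemf_coeff p1)// big1// => i _.
  rewrite mcoeffZ mcoeffX; case: eqP => [im|]; last by rewrite mulr0.
  by rewrite -im mdeg1 in m1.
have /mdeg1P[i /eqP ->] : mdeg m == 1%N by apply/eqP.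
rewrite (bigD1 i)//= mcoeffZ mcoeffX eqxx mulr1 big1 ?addr0// => j /negbTE ji.
by rewrite mcoeffZ mcoeffX eq_mnm1 ji mulr0.
Qed.

Lemma linmapE (R : realType) (n k : nat) (l : k.-tuple {mpoly R[n]})
    (z : 'rV[R]_n) :
  (forall i, linear_form (tnth l i)) -> linmap l z = z *m form_mx l.
Proof.
move=> l_lin; apply/rowP => j; rewrite !mxE [tnth l j in LHS]linear_formE//.
rewrite peval_linear_comb; apply: eq_bigr => i _.
by rewrite mxE mulrC.
Qed.

(** A coordinate in the span is constant on the fibres of [l], so fixing it costs no further linear
    condition. *)
Lemma in_span_eq (R : realType) (n k : nat) (l : k.-tuple {mpoly R[n]})
    (i : 'I_n) (z w : 'rV[R]_n) :
  in_span l (mvar R i) -> linmap l z = linmap l w -> z ord0 i = w ord0 i.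
Proof.
move=> [c Zi] lzw.
have coordE (u : 'rV[R]_n) : u ord0 i = \sum_(j < k) c j * (linmap l u) ord0 j.
  rewrite -[LHS](mevalXU (u ord0)) -[mpolyX _ _]/(mvar R i) Zi raddf_sum/=.
  by apply: eq_bigr => j _; rewrite mevalZ mxE.
by rewrite !coordE lzw.
Qed.

(** Here [f] factors through [x] -> [linmap l (esym_vec x)]; sufficiency enters the proof only in
    this way. *)
Lemma sufficient_eq (R : realType) (n k : nat) (l : k.-tuple {mpoly R[n]})
    (f : {mpoly R[n]}) (x y : 'rV[R]_n) :
  sufficient l f -> linmap l (esym_vec x) = linmap l (esym_vec y) ->
  peval f x = peval f y.
Proof.
move=> [g [-> [h ->]]] lxy; rewrite !peval_esyms /peval !comp_mpoly_meval.
apply: meval_eq => i.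
by have := congr1 (fun v : 'rV[R]_k => v ord0 i) lxy; rewrite !mxE.
Qed.

(** The describing polynomials are constant on fibres, so [S] is a union of fibres and minimisers
    found on a fibre stay in [S]. *)
Lemma sufficient_set_eq (R : realType) (n k : nat) (l : k.-tuple {mpoly R[n]})
    (S : set 'rV[R]_n) (x y : 'rV[R]_n) :
  sufficient_set l S -> linmap l (esym_vec x) = linmap l (esym_vec y) ->
  S x -> S y.
Proof.
move=> [D [D_suff ->]] lxy [c cD [c1 c2]]; exists c => //.
have cE p : p \in c.1 ++ c.2 -> peval p x = peval p y.
  by move=> pc; apply: sufficient_eq lxy; exact: D_suff cD _ pc.
split=> p pc; rewrite -cE ?mem_cat ?pc ?orbT//; [exact: c1|exact: c2].
Qed.

(** Used to restrict concavity on hyperbolic slices to the range of [esym_vec]. *)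
Lemma hyperbolic_esym (R : realType) (n : nat) (x : 'rV[R]_n) :
  hyperbolic (esym_vec x).
Proof.
move=> w; rewrite hpoly_esym rmorph_prod/=.
under eq_bigr => i _ do rewrite rmorphB/= map_polyX map_polyC/=.
rewrite -(big_map (fun i => real_complex R (x ord0 i)) xpredT
  (fun u => 'X - u%:P)) root_prod_XsubC.
by move=> /mapP[i _ ->].
Qed.

(** * Completeness and testability, fibre by fibre *)

Lemma complete_fiber (R : realType) (n m : nat) (S : set 'rV[R]_n)
    (f : {mpoly R[n]}) :
  (forall x, S x -> exists y, [/\ S y, distinct_le m y & peval f y = peval f x]) ->
  complete m S f.
Proof.
move=> Sf; apply/seteqP; split => [_ [x /Sf[y [Sy ym <-]] <-]|_ [x [Sx _] <-]].
  by exists y.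
by exists x.
Qed.

Lemma testable_fiber (R : realType) (n m : nat) (S : set 'rV[R]_n)
    (f : {mpoly R[n]}) :
  (forall x, S x -> exists y, [/\ S y, distinct_le m y & peval f y <= peval f x]) ->
  testable m S f.
Proof.
move=> Sf; apply/eqP; rewrite eq_le; apply/andP; split.
  by apply: ereal_inf_le_tmp => _ [x [Sx _] <-]; exists x.
apply/ereal_infP => _ [x /Sf[y [Sy ym fyx]] <-].
by apply: ge_ereal_inf; exists (peval f y)%:E; [exists y|rewrite lee_fin].
Qed.

Lemma concave_on_sub (R : realType) (n : nat) (D D' : set 'rV[R]_n)
    (h : 'rV[R]_n -> R) : D `<=` D' -> concave_on D' h -> concave_on D h.
Proof. by move=> DD' hD' z w zwD; apply: hD' => t /zwD/DD'. Qed.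

(** [A] stands for the matrix of [l], possibly enlarged by columns that fix coordinates; its number
    of columns is the bound obtained. This covers the general and the special case at once. *)
Lemma complete_sufficient (R : realType) (n k m : nat)
    (l : k.-tuple {mpoly R[n]}) (S : set 'rV[R]_n) (f : {mpoly R[n]})
    (A : 'M[R]_(n, m)) : (0 < m)%N ->
  (forall z w : 'rV[R]_n, z *m A = w *m A -> linmap l z = linmap l w) ->
  (forall z w : 'rV[R]_n, z *m A = w *m A ->
    forall i : 'I_n, i = 0%N :> nat -> z ord0 i = w ord0 i) ->
  sufficient_set l S -> sufficient l f -> complete m S f.
Proof.
move=> m0 lA e1 S_suff f_suff; apply: complete_fiber => x Sx.
have [y [/lA lyx ym]] := few_distinct_e1 x m0 e1.
exists y; split => //; first exact: sufficient_set_eq S_suff (esym lyx) Sx.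
exact: sufficient_eq f_suff lyx.
Qed.

Lemma testable_concave (R : realType) (n k m : nat)
    (l : k.-tuple {mpoly R[n]}) (S : set 'rV[R]_n) (f : {mpoly R[n]})
    (A : 'M[R]_(n, m)) : (0 < m)%N ->
  (forall z w : 'rV[R]_n, z *m A = w *m A -> linmap l z = linmap l w) ->
  (forall z w : 'rV[R]_n, z *m A = w *m A ->
    forall i : 'I_n, (i < 2)%N -> z ord0 i = w ord0 i) ->
  sufficient_set l S -> concave_sufficient l f -> testable m S f.
Proof.
move=> m0 lA e12 S_suff [g [-> g_concave]]; apply: testable_fiber => x Sx.
have [|y [/lA lyx fyx ym]] := @min_few_distinct_e12 _ _ _ A g x m0 e12.
  (* The fibre of [A] lies in a single hyperbolic slice of [l]. *)
  apply: concave_on_sub (g_concave (linmap l (esym_vec x))).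
  by move=> z [[u _ <-] /lA lux]; split => //; exact: hyperbolic_esym.
exists y; split => //; first exact: sufficient_set_eq S_suff (esym lyx) Sx.
by rewrite !peval_esyms.
Qed.

(** The sufficient coefficients of [f] are constant on the fibre and can be frozen at [x]. *)
Lemma quasi_sufficient_fiber (R : realType) (n k : nat)
    (l : k.-tuple {mpoly R[n]}) (f : {mpoly R[n]}) (x : 'rV[R]_n) :
  quasi_sufficient l f -> exists (b : R) (c : 'I_n -> R), forall y,
    linmap l (esym_vec y) = linmap l (esym_vec x) ->
    peval f y = b + \sum_(i < n) c i * esym_vec y ord0 i.
Proof.
move=> [f0 [fe [f0_suff fe_suff ->]]].
exists (peval f0 x), (fun i => peval (fe i) x) => y lyx.
rewrite -(sufficient_eq f0_suff lyx) /peval mevalD raddf_sum/=; congr (_ + _).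
apply: eq_bigr => i _; rewrite mevalM mxE; congr (_ * _).
exact: sufficient_eq (fe_suff i) lyx.
Qed.

(* On a fibre f = b + c(e_1, .., e_n) is affine, so adding the linear form c to
   l makes f sufficient there. *)
Lemma complete_quasi_sufficient (R : realType) (n k m : nat)
    (l : k.-tuple {mpoly R[n]}) (S : set 'rV[R]_n) (f : {mpoly R[n]})
    (A : 'M[R]_(n, m)) :
  (forall z w : 'rV[R]_n, z *m A = w *m A -> linmap l z = linmap l w) ->
  (forall z w : 'rV[R]_n, z *m A = w *m A ->
    forall i : 'I_n, i = 0%N :> nat -> z ord0 i = w ord0 i) ->
  sufficient_set l S -> quasi_sufficient l f -> complete m.+1 S f.
Proof.
move=> lA e1 S_suff f_quasi; apply: complete_fiber => x Sx.
have [b [c fE]] := quasi_sufficient_fiber x f_quasi.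
(* The added column fixes the affine part of [f] and accounts for the bound [m.+1]; it depends on
   the fibre of [x]. *)
pose A' : 'M[R]_(n, 1 + m) := row_mx (\col_i c i) A.
have A'E (z w : 'rV[R]_n) : z *m A' = w *m A' ->
    z *m (\col_i c i) = w *m (\col_i c i) /\ z *m A = w *m A.
  by rewrite !mul_mx_row => /eq_row_mx.
have [|y [/A'E[cyx /lA lyx] ym]] := @few_distinct_e1 _ _ _ A' x isT.
  by move=> z w /A'E[_]; exact: e1.
exists y; split => //; first exact: sufficient_set_eq S_suff (esym lyx) Sx.
rewrite !fE//; congr (_ + _).
have := congr1 (fun u : 'rV[R]_1 => u ord0 ord0) cyx; rewrite !mxE => cyx1.
transitivity (\sum_j esym_vec y ord0 j * (\col_i c i) j ord0).
  by apply: eq_bigr => i _; rewrite [(\col__ _) _ _]mxE mulrC.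
by rewrite cyx1; apply: eq_bigr => i _; rewrite [(\col__ _) _ _]mxE mulrC.
Qed.

(** The value at [x] lies between two values taken on the connected set, whose image is an interval.
    The point where it is attained may leave the fibre of [x]. *)
Lemma complete_quasi_sufficient_connected (R : realType) (n k m : nat)
    (l : k.-tuple {mpoly R[n]}) (S : set 'rV[R]_n) (f : {mpoly R[n]})
    (A : 'M[R]_(n, m)) : (0 < m)%N ->
  (forall z w : 'rV[R]_n, z *m A = w *m A -> linmap l z = linmap l w) ->
  (forall z w : 'rV[R]_n, z *m A = w *m A ->
    forall i : 'I_n, (i < 2)%N -> z ord0 i = w ord0 i) ->
  sufficient_set l S -> quasi_sufficient l f ->
  connected (S `&` @distinct_le R n m) -> complete m S f.
Proof.
move=> m0 lA e12 S_suff f_quasi S_conn; apply: complete_fiber => x Sx.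
have [b [c fE]] := quasi_sufficient_fiber x f_quasi.
have fibre (d : 'I_n -> R) : exists y, [/\ S y, distinct_le m y,
    linmap l (esym_vec y) = linmap l (esym_vec x) &
    \sum_(i < n) d i * esym_vec y ord0 i <= \sum_(i < n) d i * esym_vec x ord0 i].
  have [|y [/lA lyx dyx ym]] := @min_few_distinct_e12 _ _ _ A
    (\sum_(i < n) d i *: mvar R i) x m0 e12; first exact: concave_linear_comb.
  exists y; split => //; first exact: sufficient_set_eq S_suff (esym lyx) Sx.
  by rewrite !peval_linear_comb in dyx.
have [y1 [Sy1 y1m ly1 le1]] := fibre c.
(* Maximising [c] is minimising [-c], which is also concave. *)
have [y2 [Sy2 y2m ly2]] := fibre (fun i => - c i).
under eq_bigr do rewrite mulNr.
under [X in _ <= X]eq_bigr do rewrite mulNr.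
rewrite !sumrN lerN2 => le2.
have f_conn : connected (peval f @` (S `&` @distinct_le R n m)).
  apply: connected_continuous_connected => //.
  by apply: continuous_subspaceT => u; exact: continuous_peval.
have f12 : peval f y1 <= peval f x <= peval f y2.
  by rewrite !fE// !lerD2l le1 le2.
have [||y [Sy ym] fyx] := (connected_intervalP _).1 f_conn _ _ _ _ _ f12.
- by exists y1.
- by exists y2.
- by exists y.
Qed.

(** * Adjoining the first coordinates to the forms, and the theorem *)

Lemma mulmx_pid_coord (R : realType) (n s : nat) (z : 'rV[R]_n) (i : 'I_n)
    (j : 'I_s) : i = j :> nat -> (z *m (pid_mx s : 'M[R]_(n, s))) ord0 j = z ord0 i.
Proof.
move=> ij; rewrite mxE (bigD1 i)//= mxE -ij ij ltn_ord eqxx mulr1 big1 ?addr0//.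
move=> u ui; rewrite mxE; case: eqP => [uj|_]; last by rewrite mulr0.
by case/eqP: ui; apply: val_inj; rewrite /= uj.
Qed.

Theorem corollary3p10 (R : realType) (n k : nat)
    (l : k.-tuple {mpoly R[n]}) (S : set 'rV[R]_n) (f : {mpoly R[n]}) :
  (1 <= k <= n)%N ->
  (forall i, linear_form (tnth l i)) ->
  lin_indep l ->
  symmetric_set S ->
  sufficient_set l S ->
  f \is mpoly.symmetric ->
  [/\ sufficient l f -> complete k.+1 S f,
      concave_sufficient l f -> testable k.+2 S f,
      quasi_sufficient l f -> connected (S `&` @distinct_le R n k) ->
        complete k.+2 S f,
      forall i1 : 'I_n, i1 = 0%N :> nat -> in_span l (mvar R i1) ->
        sufficient l f -> complete k S f &
      forall i1 i2 : 'I_n, i1 = 0%N :> nat -> i2 = 1%N :> nat ->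
        in_span l (mvar R i1) -> in_span l (mvar R i2) ->
        (concave_sufficient l f -> testable k S f) /\
        (quasi_sufficient l f -> connected (S `&` @distinct_le R n k) ->
          complete k S f)].
Proof.
move=> /andP[k0 _] l_lin _ _ S_suff _.
pose L := form_mx l.
have LE (z w : 'rV[R]_n) : z *m L = w *m L -> linmap l z = linmap l w.
  by rewrite !linmapE.
(* Fixes the first [s] of the e_i besides [l]. For [s = 2] and [n = 1] the second added column is
   zero. *)
pose P s : 'M[R]_(n, s + k) := row_mx (pid_mx s) L.
have PE s (z w : 'rV[R]_n) : z *m P s = w *m P s -> linmap l z = linmap l w.
  by rewrite !mul_mx_row => /eq_row_mx[_]; exact: LE.
have Pe s (z w : 'rV[R]_n) : z *m P s = w *m P s ->
    forall i : 'I_n, (i < s)%N -> z ord0 i = w ord0 i.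
  rewrite !mul_mx_row => /eq_row_mx[zw _] i si.
  by rewrite -!(@mulmx_pid_coord _ _ _ _ i (Ordinal si))// zw.
have P1 (z w : 'rV[R]_n) : z *m P 1%N = w *m P 1%N ->
    forall i : 'I_n, i = 0%N :> nat -> z ord0 i = w ord0 i.
  by move=> /Pe zw i i0; apply: zw; rewrite i0.
split.
- exact: (complete_sufficient (A := P 1%N) isT (@PE 1%N) P1 S_suff).
- exact: (testable_concave (A := P 2%N) isT (@PE 2%N) (@Pe 2%N) S_suff).
(* The [k + 2] conditions are [l], e_1 and the affine part of [f]. *)
- move=> f_quasi _.
  exact: (complete_quasi_sufficient (@PE 1%N) P1 S_suff f_quasi).
- move=> i1 i10 span1; apply: (@complete_sufficient _ _ _ k l S f L) => //.
  move=> z w /LE lzw i i0.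
  have -> : i = i1 by apply: val_inj; rewrite /= i0 i10.
  exact: in_span_eq span1 lzw.
move=> i1 i2 i10 i21 span1 span2.
(* Under the span hypotheses [L] alone fixes e_1 and e_2, so [k] columns suffice. *)
have e12 (z w : 'rV[R]_n) : z *m L = w *m L ->
    forall i : 'I_n, (i < 2)%N -> z ord0 i = w ord0 i.
  move=> /LE lzw i; rewrite ltnS leq_eqVlt ltnS leqn0 => /orP[]/eqP i_eq.
    have -> : i = i2 by apply: val_inj; rewrite /= i_eq i21.
    exact: in_span_eq span2 lzw.
  have -> : i = i1 by apply: val_inj; rewrite /= i_eq i10.
  exact: in_span_eq span1 lzw.
split.
  exact: (testable_concave k0 LE e12 S_suff).
exact: (complete_quasi_sufficient_connected k0 LE e12 S_suff).
Qed.
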